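(* Let $G$ be a finite, simple, undirected, connected graph on $n\geq 3$ vertices which has no induced $C_4$ and has no pair of false-twin vertices, and such that the set $\mathcal{A}$ of alone vertices of $G$ has a good assignment. Then $G$ has at least $\lceil \frac{n}{2} \rceil$ bicliques.
   Context: All graphs are finite, simple, undirected and connected (standing assumption of the paper). A biclique of $G$ is a maximal (with respect to vertex-set inclusion) induced subgraph of $G$ that is a complete bipartite graph $K_{p,q}$ with $p,q\geq 1$; bicliques are counted as distinct vertex sets. $N(v)$ is the open neighborhood and $N[v]=N(v)\cup\{v\}$ the closed neighborhood. Two distinct vertices $u,v$ are false-twins if $N(u)=N(v)$ and true-twins if $N[u]=N[v]$. A vertex $v$ is dominated by a vertex $v'$ if $N[v]\subseteq N[v']$. A vertex $v$ is simplicial if $\{v\}\cup N(v)$ is a clique. A vertex $x$ is alone if $x$ is simplicial and no vertex of $N(x)$ is simplicial; $\mathcal{A}$ denotes the set of alone vertices. An assignment for $\mathcal{A}$ associates to each alone vertex $x$ a vertex $v$ and an edge $vv'$ with $v,v'\in N(x)$, such that either $v$ is not dominated by $v'$ or $v$ and $v'$ are true-twins. The assignment is good if whenever two different alone vertices have the same associated edge, the endpoints of that edge are not true-twins and the vertices associated to the two alone vertices are different. $\mathcal{A}$ has a good assignment if some good assignment for $\mathcal{A}$ exists. *)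

(* Defs.v *)
From mathcomp Require Import all_boot.

Set Implicit Arguments.
Unset Strict Implicit.
Unset Printing Implicit Defensive.

(* A graph on the vertex set [T] is given by its adjacency relation [e]; that
   [e] is symmetric and irreflexive is assumed where graphs are quantified. *)

Definition connected_graph (T : finType) (e : rel T) : Prop :=
  forall x y : T, connect e x y.

Definition nbh (T : finType) (e : rel T) (v : T) : {set T} := [set u | e v u].

Definition cnbh (T : finType) (e : rel T) (v : T) : {set T} := v |: nbh e v.

Definition clique (T : finType) (e : rel T) (A : {set T}) : bool :=
  [forall x in A, forall y in A, (x != y) ==> e x y].

Definition stable (T : finType) (e : rel T) (A : {set T}) : bool :=
  [forall x in A, forall y in A, ~~ e x y].

(* [B] induces a K_{p,q} with p, q >= 1, the two sides being [X] and [Y]. *)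
Definition complete_bipartite (T : finType) (e : rel T) (B : {set T}) : bool :=
  [exists X : {set T}, exists Y : {set T},
    [&& X != set0, Y != set0, [disjoint X & Y], B == X :|: Y,
        stable e X, stable e Y & [forall x in X, forall y in Y, e x y]]].

Definition biclique (T : finType) (e : rel T) (B : {set T}) : bool :=
  maxset (complete_bipartite e) B.

Definition bicliques (T : finType) (e : rel T) : {set {set T}} :=
  [set B | biclique e B].

Definition induced_C4_free (T : finType) (e : rel T) : Prop :=
  ~ exists a b c d : T,
      [&& uniq [:: a; b; c; d], e a b, e b c, e c d, e d a,
          ~~ e a c & ~~ e b d].

Definition false_twins (T : finType) (e : rel T) (u v : T) : bool :=
  (u != v) && (nbh e u == nbh e v).

Definition true_twins (T : finType) (e : rel T) (u v : T) : bool :=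
  (u != v) && (cnbh e u == cnbh e v).

Definition dominated (T : finType) (e : rel T) (v v' : T) : bool :=
  cnbh e v \subset cnbh e v'.

Definition simplicial (T : finType) (e : rel T) (v : T) : bool :=
  clique e (cnbh e v).

Definition alone (T : finType) (e : rel T) (x : T) : bool :=
  simplicial e x && [forall y in nbh e x, ~~ simplicial e y].

(* [a x = (v, v')] encodes the vertex [v] and the edge vv' associated to [x];
   the values of [a] outside the alone vertices are irrelevant. *)
Definition assignment (T : finType) (e : rel T) (a : T -> T * T) : Prop :=
  forall x : T, alone e x ->
    let: (v, v') := a x in
    [/\ v \in nbh e x, v' \in nbh e x, e v v'
      & ~~ dominated e v v' \/ true_twins e v v'].

(* Edges are compared as unordered pairs of vertices. *)
Definition good_assignment (T : finType) (e : rel T) (a : T -> T * T) : Prop :=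
  assignment e a /\
  forall x y : T, alone e x -> alone e y -> x != y ->
    [set (a x).1; (a x).2] = [set (a y).1; (a y).2] ->
    ~~ true_twins e (a x).1 (a x).2 /\ (a x).1 != (a y).1.

(* Main.v *)
Require Import Defs.
From mathcomp Require Import all_boot.

Set Implicit Arguments.
Unset Strict Implicit.
Unset Printing Implicit Defensive.

(* In a C4-free graph the bicliques are the edges joining true twins and the
   stars [c |: I] with [I] a maximal stable subset of N(c) with at least two
   elements.  Every vertex [x] is charged to a biclique:
   - a non-simplicial [x] to a star centred at [x] having all the alone
     neighbours of [x] as leaves;
   - a simplicial [x] with a simplicial neighbour [y] to the twin edge [xy];
   - an alone [x], with associated vertex [v] and edge [vv'], to the edge [vv']
     if [v] and [v'] are true twins, and otherwise to a star centred at [v]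
     having as leaves [v'] and all the alone neighbours of [v] that are not
     adjacent to [v'].
   Only edges between simplicial vertices are charged more than once, and these
   are charged only by their two endpoints, so n is at most twice the number of
   bicliques. *)

(** Every fibre of [f] has at most two elements: once a fibre over [B] has two, all its elements lie
    in [B] and [B] has at most two. *)
Lemma card_le_double (T : finType) (F : {set {set T}}) (f : T -> {set T}) :
    (forall x, f x \in F) ->
    (forall x y, x != y -> f x = f y -> y \in f x /\ #|f x| <= 2) ->
  #|T| <= #|F|.*2.
Proof.
move=> fF f2; rewrite -cardsT -sum1_card (partition_big f (mem F)) => [|x _] //=.
rewrite -muln2 -sum_nat_const; apply: leq_sum => B _; rewrite sum1dep_card.
set A := [set x | _]; have [A1|/card_gt1P[x [y [xA yA xy]]]] := leqP #|A| 1.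
  exact: leq_trans A1 _.
have fA z : z \in A -> f z = B by rewrite !inE => /eqP.
have [_ B2] := f2 x y xy (etrans (fA x xA) (esym (fA y yA))).
rewrite fA // in B2; apply: leq_trans B2; apply/subset_leq_card/subsetP => z zA.
have mem t : t \in A -> t != z -> z \in B.
  by move=> tA tz; have [] := f2 t z tz; rewrite ?fA.
by have [zx|] := eqVneq x z; [apply: (mem y); rewrite // -zx eq_sym | apply: mem].
Qed.

(** * Simplicial vertices and twin edges *)

Section C4Free.

Variables (T : finType) (e : rel T).
Hypotheses (e_sym : symmetric e) (e_irr : irreflexive e).
Implicit Types (x y u v w c : T) (I S B X Y : {set T}).

Lemma stableP S : reflect {in S &, forall x y, ~~ e x y} (stable e S).
Proof.
apply: (iffP forall_inP) => [h x y xS yS|h x xS].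
  exact: (forall_inP (h x xS)).
by apply/forall_inP => y yS; apply: h.
Qed.

Lemma simplicial_adj x y z :
  simplicial e x -> e x y -> e x z -> y != z -> e y z.
Proof.
move=> /forall_inP sx xy xz yz; have: y \in cnbh e x by rewrite !inE xy orbT.
move/sx/forall_inP/(_ z); rewrite !inE xz orbT yz; exact.
Qed.

Lemma true_twins_adj u v : true_twins e u v -> e u v.
Proof.
case/andP => uv /eqP/setP/(_ v); rewrite !inE eqxx /=.
by rewrite eq_sym (negPf uv).
Qed.

Lemma simplicial_true_twins x y :
  simplicial e x -> simplicial e y -> e x y -> true_twins e x y.
Proof.
have sub u v : simplicial e u -> e u v -> cnbh e u \subset cnbh e v.
  move=> su uv; apply/subsetP => w; rewrite !inE => /orP[/eqP->|uw].
    by rewrite e_sym uv orbT.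
  by have [//|wv] := eqVneq w v; rewrite (simplicial_adj su uv uw) // eq_sym.
move=> sx sy xy; apply/andP; split.
  by apply: contraTneq xy => ->; rewrite e_irr.
by rewrite eqEsubset !sub // e_sym.
Qed.

Lemma not_simplicialP x : ~~ simplicial e x ->
  exists p q, [/\ e x p, e x q, p != q & ~~ e p q].
Proof.
rewrite /simplicial /clique => /forall_inPn[p px /forall_inPn[q qx]].
rewrite negb_imply => /andP[pq npq]; exists p, q.
move: px qx; rewrite !inE => /orP[/eqP px|xp] /orP[/eqP qx|xq] //.
- by rewrite px qx eqxx in pq.
- by rewrite px xq in npq.
- by rewrite qx e_sym xp in npq.
Qed.

Lemma complete_bipartiteP B :
  reflect (exists X Y, [/\ X != set0, Y != set0, B = X :|: Y /\ stable e X, stable e Y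
             & {in X & Y, forall x y, e x y}])
          (complete_bipartite e B).
Proof.
apply: (iffP existsP) => [[X /existsP[Y]]|[X [Y [X0 Y0 [-> sX] sY eXY]]]].
  case/and5P => X0 Y0 _ /eqP-> /and3P[sX sY eXY]; exists X, Y; split=> // x y xX yY.
  by move/forall_inP/(_ x xX)/forall_inP: eXY; apply.
exists X; apply/existsP; exists Y; rewrite X0 Y0 eqxx sX sY /=; apply/andP; split.
  (* A vertex on both sides would carry a loop. *)
  apply/pred0P => x /=; apply: contraFF (e_irr x) => /andP[xX xY]; exact: eXY.
by apply/forall_inP => x xX; apply/forall_inP => y yY; apply: eXY.
Qed.

Lemma stable1 x : stable e [set x].
Proof. by apply/stableP => y z /set1P-> /set1P->; rewrite e_irr. Qed.

(** In a larger biclique, a vertex on the side of [u] is adjacent to [v], hence lies in the closed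
    neighborhood of [u]; as sides are stable, it is [u]. The side of [v] is symmetric. *)
Lemma true_twins_biclique u v : true_twins e u v -> biclique e [set u; v].
Proof.
move=> tuv; have uv := true_twins_adj tuv; case/andP: tuv => _ /eqP/setP N_uv.
apply/maxsetP; split.
  apply/complete_bipartiteP; exists [set u], [set v]; split; rewrite ?stable1 //.
  - by apply/set0Pn; exists u; rewrite inE.
  - by apply/set0Pn; exists v; rewrite inE.
  - by move=> x y /set1P-> /set1P->.
move=> B /complete_bipartiteP[X [Y [_ _ [-> sX] sY eXY]]] /subUsetP[].
rewrite !sub1set => uB vB.
wlog uX : X Y sX sY eXY uB vB / u \in X.
  move=> hw; case/setUP: (uB) => [|uY]; first exact: hw.
  rewrite setUC; apply: hw; rewrite // 1?setUC // => x y xX yY.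
  by rewrite e_sym eXY.
have vY : v \in Y.
  by case/setUP: vB => // vX; rewrite (negPf (stableP _ sX u v uX vX)) in uv.
apply/eqP; rewrite eqEsubset; apply/andP; split; last first.
  by rewrite subUset !sub1set uB vB.
apply/subsetP => w /setUP[wX|wY].
  move: (N_uv w); rewrite !inE (negPf (stableP _ sX _ _ uX wX)) orbF.
  by rewrite (e_sym v) (eXY w v) // orbT => ->.
move: (N_uv w); rewrite !inE (negPf (stableP _ sY _ _ vY wY)) orbF.
by rewrite (eXY u w) // !orbT => <-; rewrite orbT.
Qed.

(** * Stars as bicliques *)

Definition maxstar c I : Prop :=
  [/\ I \subset nbh e c, stable e I, 1 < #|I|
    & forall w, e c w -> {in I, forall s, ~~ e w s} -> w \in I].

(** In a larger biclique, a vertex [w] other than [c] on the side of [c] would form an induced C4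
    with [c] and two leaves; a vertex on the other side is a leaf already, by maximality of [I]. *)
Lemma maxstar_biclique c I :
  induced_C4_free e -> maxstar c I -> biclique e (c |: I).
Proof.
move=> noC4 [/subsetP Ic sI /card_gt1P[s [t [sIn tIn st]]] maxI].
have eI x : x \in I -> e c x by move/Ic; rewrite inE.
apply/maxsetP; split.
  apply/complete_bipartiteP; exists [set c], I; split; rewrite ?stable1 //.
  - by apply/set0Pn; exists c; rewrite inE.
  - by apply/set0Pn; exists s.
  - by move=> x y /set1P-> /eI.
move=> B /complete_bipartiteP[X [Y [_ _ [-> sX] sY eXY]]] /subUsetP[].
rewrite sub1set => cB /subsetP IB.
wlog cX : X Y sX sY eXY cB IB / c \in X.
  move=> hw; case/setUP: (cB) => [|cY]; first exact: hw.
  rewrite setUC; apply: hw; rewrite // 1?setUC // => x y xX yY.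
  by rewrite e_sym eXY.
have IY x : x \in I -> x \in Y.
  move=> xI; case/setUP: (IB x xI) => // xX.
  by have := stableP _ sX c x cX xX; rewrite eI.
apply/eqP; rewrite eqEsubset; apply/andP; split; last first.
  by rewrite subUset sub1set cB; apply/subsetP.
apply/subsetP => w /setUP[wX|wY]; rewrite !inE.
  apply: contraT => /norP[wc _]; case: noC4; exists c, s, w, t.
  rewrite (stableP _ sX c w) // (stableP _ sI s t) // (e_sym s w) (e_sym t c).
  rewrite (eXY w) ?IY // (eXY w) ?IY // !eI //= !andbT !inE !negb_or.
  have nY z y : z \in X -> y \in I -> z != y.
    by move=> zX yI; apply: contraTneq (eXY z y zX (IY y yI)) => ->; rewrite e_irr.
  by rewrite (nY c s) // (nY c t) // (nY w t) // eq_sym wc st eq_sym (nY w s).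
apply/orP; right; apply: maxI; first exact: eXY.
by move=> x /IY xY; apply: (stableP _ sY).
Qed.

(** The vertex [u] guarantees a second leaf: a maximal stable set reduced to [s] could still be
    enlarged by [u]. *)
Lemma maxstar_exists c S s u :
    S \subset nbh e c -> stable e S -> s \in S ->
    e c u -> u != s -> ~~ e s u ->
  exists2 I, maxstar c I & S \subset I.
Proof.
move=> Sc sS sIn cu us nsu.
pose P I := (I \subset nbh e c) && stable e I.
have [|I /maxsetP[/andP[Ic sI] maxI] SI] := @maxset_exists _ P S.
  by rewrite /P Sc.
have max w : e c w -> {in I, forall s, ~~ e w s} -> w \in I.
  move=> cw wI; rewrite -(maxI (w |: I)) ?setU11 ?subsetUr //.
  rewrite /P subUset sub1set inE cw Ic /=; apply/stableP => x y.
  move=> /setU1P[->|xI] /setU1P[->|yI]; rewrite ?e_irr ?wI //.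
    by rewrite e_sym wI.
  exact: (stableP _ sI).
exists I => //; split=> //; rewrite ltnNge; apply/negP => I1.
have Is : I = [set s].
  by apply/eqP; rewrite eq_sym eqEcard sub1set cards1 I1 (subsetP SI).
have: u \in I by apply: max => // x; rewrite Is => /set1P->; rewrite e_sym.
by rewrite Is inE (negPf us).
Qed.

Lemma maxstar_notin c I : maxstar c I -> c \notin I.
Proof. by case=> /subsetP Ic _ _ _; apply/negP => /Ic; rewrite inE e_irr. Qed.

Lemma card_maxstar c I : maxstar c I -> 2 < #|c |: I|.
Proof. by move=> cI; rewrite cardsU1 maxstar_notin //; case: cI. Qed.

(** If the centres differed, [c] and some leaf [s] of [c] other than [d] would both be leaves of
    [d], yet they are adjacent. *)
Lemma maxstar_inj c d I J :
  maxstar c I -> maxstar d J -> c |: I = d |: J -> c = d /\ I = J.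
Proof.
move=> cI dJ eqIJ; have cd : c = d.
  apply/eqP/negPn/negP => cd.
  have cJ : c \in J by have := setU11 c I; rewrite eqIJ !inE (negPf cd).
  have [/subsetP Ic sI I1 _] := cI; have [_ sJ _ _] := dJ.
  have [s sIn sd] : exists2 s, s \in I & s != d.
    case/card_gt1P: I1 => s [t [sIn tIn st]].
    by have [sd|] := eqVneq s d; [exists t; rewrite -?sd 1?eq_sym | exists s].
  have sJin : s \in J by have := setU1r c sIn; rewrite eqIJ !inE (negPf sd).
  by have := stableP _ sJ c s cJ sJin; have := Ic s sIn; rewrite inE => ->.
split=> //; rewrite -(setU1K (maxstar_notin cI)) eqIJ cd.
by rewrite setU1K // maxstar_notin.
Qed.

(** * Stars with alone leaves *)

Definition alone_nbh v : {set T} := [set y in nbh e v | alone e y].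

Lemma alone_stable S : {in S, forall x, alone e x} -> stable e S.
Proof.
move=> aS; apply/stableP => x y /aS/andP[_ /forall_inP ax] /aS/andP[sy _].
by apply/negP => xy; have := ax y; rewrite inE xy sy => /(_ isT).
Qed.

Lemma alone_nbhS v : alone_nbh v \subset nbh e v.
Proof. by apply/subsetP => y /setIdP[]. Qed.

Lemma maxstar_center v : ~~ simplicial e v ->
  exists2 I, maxstar v I & alone_nbh v \subset I.
Proof.
move=> nsv; have [p [q [vp vq pq npq]]] := not_simplicialP nsv.
have sA : stable e (alone_nbh v) by apply: alone_stable => x /setIdP[].
have [A0|[s sA0]] := set_0Vmem (alone_nbh v).
  have [||||||I vI _] := @maxstar_exists v [set p] p q.
  - by rewrite sub1set inE.
  - exact: stable1.
  - by rewrite inE.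
  - by [].
  - by rewrite eq_sym.
  - by [].
  by exists I; rewrite // A0 sub0set.
(* One of [p], [q] serves as [u]: the simplicial vertex [s] cannot be adjacent to both, since they
   are not adjacent. *)
have [u [vu us nsu]] : exists u, [/\ e v u, u != s & ~~ e s u].
  have [ps|ps] := eqVneq p s; first by exists q; rewrite -ps eq_sym.
  have [sp|] := boolP (e s p); last by exists p.
  have [qs|qs] := eqVneq q s.
    by exists p; rewrite -qs (e_sym q).
  exists q; split=> //; apply: contra npq => sq.
  by case/setIdP: sA0 => _ /andP[ss _]; apply: (simplicial_adj ss).
exact: maxstar_exists (alone_nbhS v) sA sA0 vu us nsu.
Qed.

(** Non-domination supplies a neighbor of [v] outside the closed neighborhood of [v'], so that a
    star with leaf [v'] has a second leaf. *)
Lemma maxstar_edge v v' : e v v' -> ~~ dominated e v v' ->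
  exists2 I, maxstar v I & v' |: (alone_nbh v :\: nbh e v') \subset I.
Proof.
move=> vv' /subsetPn[u]; rewrite !inE => /orP[/eqP->|vu].
  by rewrite e_sym vv' orbT.
case/norP => uv' nv'u; apply: (maxstar_exists (s := v')) vu uv' nv'u.
- rewrite subUset sub1set inE vv'.
  exact: subset_trans (subsetDl _ _) (alone_nbhS v).
- have /stableP sA : stable e (alone_nbh v) by apply: alone_stable => x /setIdP[].
  apply/stableP => x y /setU1P[->|/setDP[xA xv']] /setU1P[->|/setDP[yA yv']].
  + by rewrite e_irr.
  + by rewrite inE in yv'.
  + by rewrite e_sym; rewrite inE in xv'.
  + exact: sA.
- exact: setU11.
Qed.

(** * Charging vertices to bicliques *)

Variable a : T -> T * T.

Inductive charge x B : Prop :=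
| ChargeCenter I of maxstar x I & alone_nbh x \subset I & B = x |: I
| ChargeSimplicial y of simplicial e x & simplicial e y & e x y & B = [set x; y]
| ChargeTwins of alone e x & true_twins e (a x).1 (a x).2
    & B = [set (a x).1; (a x).2]
| ChargeLeaf I of alone e x & maxstar (a x).1 I
    & (a x).2 |: (alone_nbh (a x).1 :\: nbh e (a x).2) \subset I
    & B = (a x).1 |: I.

Lemma charge_exists x : assignment e a -> exists B, charge x B.
Proof.
move=> asg; have [sx|nsx] := boolP (simplicial e x); last first.
  have [I xI AI] := maxstar_center nsx.
  by exists (x |: I); apply: ChargeCenter AI _.
have [ax|] := boolP (alone e x); last first.
  rewrite /alone sx /= => /forall_inPn[y]; rewrite inE negbK => xy sy.
  by exists [set x; y]; apply: ChargeSimplicial xy _.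
have [tt|ntt] := boolP (true_twins e (a x).1 (a x).2).
  by exists [set (a x).1; (a x).2]; apply: ChargeTwins.
have := asg x ax; case E: (a x) ntt => [v v'] /= ntt [_ _ vv' [nd|]]; last first.
  by rewrite (negPf ntt).
have [I vI AI] := maxstar_edge vv' nd.
by exists (v |: I); apply: (@ChargeLeaf _ _ I); rewrite // E.
Qed.

Lemma charge_biclique x B : induced_C4_free e -> charge x B -> biclique e B.
Proof.
move=> noC4 [I xI _ ->|y sx sy xy ->|_ tt ->|I _ xI _ ->].
- exact: maxstar_biclique.
- exact/true_twins_biclique/simplicial_true_twins.
- exact: true_twins_biclique.
- exact: maxstar_biclique.
Qed.

Hypothesis good : good_assignment e a.

Lemma alone_assignment x : alone e x ->
  [/\ e x (a x).1, e x (a x).2, e (a x).1 (a x).2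
    & ~~ simplicial e (a x).1].
Proof.
move=> ax; have := good.1 x ax; case: (a x) => v v' /= [].
rewrite !inE => xv xv' vv' _; split=> //.
by case/andP: ax => _ /forall_inP; apply; rewrite inE.
Qed.

(** The vertex [x] is an alone neighbor of [(a x).1] but is adjacent to [(a x).2]. This separates
    the stars of [ChargeLeaf] from those of [ChargeCenter]. *)
Lemma alone_nbh_not_sub x I :
    alone e x -> stable e I -> (a x).2 \in I ->
  ~~ (alone_nbh (a x).1 \subset I).
Proof.
move=> ax /stableP sI vI; have [xv xv' _ _] := alone_assignment ax.
apply/negP => /subsetP/(_ x); rewrite !inE e_sym xv ax => /(_ isT) xI.
by have := sI _ _ xI vI; rewrite xv'.
Qed.

Lemma charge_twice x y B :
  x != y -> charge x B -> charge y B -> y \in B /\ #|B| <= 2.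
Proof.
have card2 u v : #|[set u; v]| <= 2 by rewrite cards2; case: (u != v).
have edge_star u v c I : maxstar c I -> [set u; v] = c |: I -> False.
  by move=> /card_maxstar + E; rewrite -E ltnNge card2.
(* The vertex associated to an alone vertex is not simplicial, so its edge never joins two
   simplicial vertices. *)
have edges x1 y1 z1 : alone e x1 -> simplicial e y1 -> simplicial e z1 ->
    [set (a x1).1; (a x1).2] = [set y1; z1] -> False.
  move=> /alone_assignment[_ _ _ ns] sy sz /setP/(_ (a x1).1).
  by rewrite set21 => /esym/set2P[]E; rewrite E ?sy ?sz in ns.
move=> xy [I xI AI ->|z sx sz xz ->|ax tx ->|I ax xI vI ->]
          [J yJ AJ|w sy sw yw|ay ty|J ay yJ vJ] E;
  try by case: (edge_star _ _ _ _ xI (esym E)).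
- by case: (maxstar_inj xI yJ E) => /eqP; rewrite (negPf xy).
- have [xy1 IJ] := maxstar_inj xI yJ E; have [_ sJ _ _] := yJ.
  have := alone_nbh_not_sub ay sJ (subsetP vJ _ (setU11 _ _)).
  by rewrite -xy1 -IJ AI.
- by case: (edge_star _ _ _ _ yJ E).
(* Two simplicial charges: the only collision that can occur. *)
- by rewrite E set21 -E.
- by case: (edges y x z ay sx sz); rewrite E.
- by case: (edge_star _ _ _ _ yJ E).
- by case: (edge_star _ _ _ _ yJ E).
- by case: (edges x y w ax sy sw).
- by have [/negP[]] := good.2 x y ax ay xy E.
- by case: (edge_star _ _ _ _ yJ E).
- have [xy1 IJ] := maxstar_inj xI yJ E; have [_ sI _ _] := xI.
  have := alone_nbh_not_sub ax sI (subsetP vI _ (setU11 _ _)).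
  by rewrite xy1 IJ AJ.
(* Two leaf charges share centre and leaves. Goodness makes [(a x).2] and [(a y).2] distinct; both
   turn out to be neighbors of the simplicial [x], hence adjacent, although both lie in the stable
   set [I]. *)
have [cxy IJ] := maxstar_inj xI yJ E.
have [_ sI _ _] := xI.
have vxI : (a x).2 \in I by rewrite (subsetP vI) ?setU11.
have vyI : (a y).2 \in I by rewrite IJ (subsetP vJ) ?setU11.
have vxy : (a x).2 != (a y).2.
  apply/eqP => vxy; have [|_] := good.2 x y ax ay xy; last by rewrite cxy eqxx.
  by rewrite cxy vxy.
have [xc xv _ _] := alone_assignment ax.
have xvy : e x (a y).2.
  (* Otherwise the star chosen for [y] has [x] as a leaf, next to the adjacent leaf [(a x).2]. *)
  apply: contraT => nxv; have xIn : x \in I.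
    rewrite IJ (subsetP vJ) // !inE (e_sym (a y).2) nxv ax -cxy.
    by rewrite e_sym xc orbT.
  by have := stableP _ sI _ _ xIn vxI; rewrite xv.
have := stableP _ sI _ _ vxI vyI; case/andP: ax => sx _.
by rewrite (simplicial_adj sx xv xvy vxy).
Qed.

End C4Free.

Unset Implicit Arguments.

Theorem theorem3p4 (T : finType) (e : rel T)
  (e_sym : symmetric e) (e_irr : irreflexive e)
  (e_conn : connected_graph e)
  (n_ge3 : 3 <= #|T|)
  (noC4 : induced_C4_free e)
  (no_false_twins : forall u v : T, ~~ false_twins e u v)
  (good : exists a : T -> T * T, good_assignment e a) :
  uphalf #|T| <= #|bicliques e|.
Proof.
case: good => a good_a.
have [f fP] : exists f : T -> {set T}, forall x, charge e a x (f x).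
  by apply: fin_all_exists => x; apply: charge_exists good_a.1.
rewrite leq_uphalf_double; apply: (@card_le_double _ _ f) => [x|x y xy fxy].
  by rewrite inE; apply: charge_biclique (fP x).
by apply: (charge_twice e_sym e_irr good_a xy (fP x)); rewrite fxy.
Qed.
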